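(* If $x$ is a cycle point for a topological tournament $R$ on a compact Hausdorff space $X$, then $\{x\}$ is a $G_\delta$ subset of $X$, and so $x$ has a countable neighborhood base in $X$.
   Context: All spaces are Hausdorff. A tournament on a nonempty set $X$ is a relation $R\subset X\times X$ with $R\cap R^{-1}=1_X=\{(x,x):x\in X\}$ and $R\cup R^{-1}=X\times X$, where $R^{-1}=\{(x,y):(y,x)\in R\}$. Its set of arcs is $R^\circ=R\setminus 1_X$. It is a topological tournament on a topological space $X$ when $R$ is closed in $X\times X$. A 3-cycle is a triple of distinct points $\{x_1,x_2,x_3\}$ with $(x_1,x_2),(x_2,x_3),(x_3,x_1)\in R^\circ$ (after a suitable ordering). A point $x\in X$ is a cycle point for $R$ when every neighborhood of $x$ contains a 3-cycle which includes $x$. *)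

(* Defs.v *)
From mathcomp Require Import all_boot.
From mathcomp Require Import boolp classical_sets functions cardinality filter.
From mathcomp Require Import topology borel_hierarchy.

Set Implicit Arguments.
Unset Strict Implicit.
Unset Printing Implicit Defensive.

Local Open Scope classical_set_scope.
Local Open Scope relation_scope.

Definition tournament (X : Type) (R : set (X * X)) : Prop :=
  [/\ [set: X] !=set0, R `&` R^-1 = diagonal & R `|` R^-1 = [set: X * X]].

Definition arcs (X : Type) (R : set (X * X)) : set (X * X) := R `\` diagonal.

Definition topological_tournament (X : topologicalType) (R : set (X * X)) :
  Prop := tournament R /\ closed R.

(* A 3-cycle is an unordered set of three points; the orientation of the cycle
   is existentially quantified. *)
Definition three_cycle (X : Type) (R : set (X * X)) (C : set X) : Prop :=
  exists x1 x2 x3 : X,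
    [/\ C = [set x1; x2; x3],
        [/\ x1 <> x2, x2 <> x3 & x3 <> x1] &
        [/\ arcs R (x1, x2), arcs R (x2, x3) & arcs R (x3, x1)]].

Definition cycle_point (X : topologicalType) (R : set (X * X)) (x : X) :
  Prop :=
  forall U : set X, nbhs x U ->
    exists C : set X, [/\ three_cycle R C, C `<=` U & C x].

Definition has_countable_nbhs_base (X : topologicalType) (x : X) : Prop :=
  exists B : set (set X), [/\ countable B, B `<=` nbhs x &
    forall U : set X, nbhs x U -> exists2 V, B V & V `<=` U].

(* Main.v *)
Require Import Defs.
From mathcomp Require Import all_boot.
From mathcomp Require Import boolp classical_sets functions cardinality filter.
From mathcomp Require Import topology borel_hierarchy.

Local Open Scope classical_set_scope.

(** Write [y -> z] for [(y, z) \in R].  Starting from [U 0 = X], choose a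
3-cycle [x -> a_n -> b_n -> x] inside an open neighborhood [U n] of [x], and
let [U n.+1] be the set of points [y] of [U n] for which neither [a_n -> y] nor
[y -> b_n].  It is again an open neighborhood of [x], since [R] is closed and
[a_n -> x], [x -> b_n] both fail.  As [R] is total, [U n.+1] lies in the closed
set [K n] of the points [y] such that [y -> a_n] and [b_n -> y].

The point is that the sets [K n] meet only in [x].  By compactness the sequence
of pairs [(a_n, b_n)] has a cluster point [(a, b)].  Closedness of [R] gives
[a -> b], and it gives [y -> a] and [b -> y] for every [y] in all the [K n].
Since [b_m] belongs to [U m], hence to [K n] whenever [m > n], the point [b] is
itself in all the [K n].  Then [b -> a -> b], so [a = b] by antisymmetry, and
[y -> a -> y] forces [y = a] for every [y] in all the [K n].  Since [x] is one
of these [y], it is the only one.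

So [x] is the only point of [\bigcap_n U n], and compactness, through
[compact_nested_nbhs_base], makes the [U n] a neighborhood base at [x]. *)

(** The closed-set form of the existence of a cluster point.  Applied to a
product space it yields a joint cluster point for a sequence of pairs. *)
Lemma compact_sequence_cluster (T : topologicalType) (u : nat -> T) :
  compact [set: T] ->
  exists z, forall C, closed C -> (\forall n \near \oo, C (u n)) -> C z.
Proof.
move=> cT.
have [z [_ uz]] := cT (u @ \oo) _ filterT.
exists z => C clC uC; apply: clC => B zB.
exact: uz.
Qed.

(** A point of [U n] outside a given neighborhood of [x], for each [n], would
produce a cluster point lying in every [K n] but different from [x]. *)
Lemma compact_nested_nbhs_base (X : topologicalType) (x : X)
    (U K : nat -> set X) :
  compact [set: X] -> (forall n, open (U n)) -> (forall n, U n x) ->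
  (forall m n, m <= n -> U n `<=` U m) ->
  (forall n, closed (K n)) -> (forall n, U n.+1 `<=` K n) ->
  \bigcap_n K n `<=` [set x] ->
  Gdelta [set x] /\ has_countable_nbhs_base x.
Proof.
move=> cX oU Ux Udecr clK UK Kx; split.
  exists U => //; apply/seteqP; split=> [_ -> n _ //|y Uy].
  by apply: Kx => n _; apply/UK/Uy.
exists (range U); split.
- exact: card_image_le.
- by move=> _ [n _ <-]; apply: open_nbhs_nbhs; split.
move=> W; rewrite nbhsE => -[V [oV Vx] VW].
suff [n UnV] : exists n, U n `<=` V.
  by exists (U n); [exists n | exact: subset_trans VW].
apply: contrapT => noU.
have /choice[z zUV] n : exists y, U n y /\ ~ V y.
  apply: contrapT => noy; apply: noU; exists n => y Uy.
  by apply: contrapT => nVy; apply: noy; exists y.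
have [y clus] := compact_sequence_cluster X z cX.
have yx : y = x.
  apply: Kx => n _; apply: clus => //.
  exists n.+1 => // m /= ltnm; apply: UK.
  by apply: Udecr ltnm _ _; have [] := zUV m.
have : (~` V) y.
  apply: clus; first exact: open_closedC.
  by exists 0%N => // m _; have [] := zUV m.
by rewrite yx.
Qed.

Section Tournament.
Variables (X : Type) (R : set (X * X)).
Hypothesis tR : tournament R.

Lemma tournament_anti y z : R (y, z) -> R (z, y) -> y = z.
Proof.
case: tR => _ RI _ Ryz Rzy.
by have : diagonal (y, z) by rewrite -RI; split.
Qed.

Lemma tournament_total y z : ~ R (y, z) -> R (z, y).
Proof.
case: tR => _ _ RU nRyz.
have : [set: X * X] (y, z) by [].
by rewrite -RU => -[].
Qed.

Lemma arcs_not_converse y z : arcs R (y, z) -> ~ R (z, y).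
Proof. by move=> [Ryz nyz] Rzy; apply: nyz; exact: tournament_anti. Qed.

End Tournament.

(** A 3-cycle through [x] can be rotated so as to start at [x]; its other two
vertices then strictly follow and strictly precede [x]. *)
Lemma cycle_point_arcs (X : topologicalType) (R : set (X * X)) (x : X)
    (U : set X) :
  tournament R -> cycle_point R x -> nbhs x U ->
  exists p : X * X, [/\ U p.1, U p.2, R p, ~ R (p.1, x) & ~ R (x, p.2)].
Proof.
move=> tR cx /cx[_ [[x1 [x2 [x3 [-> _ [R12 R23 R31]]]]] CU Cx]].
have [U1 U2 U3] : [/\ U x1, U x2 & U x3].
  by split; apply: CU; [left; left | left; right | right].
have nR := arcs_not_converse _ _ tR.
case: Cx => [[|]|] /= ->.
- by exists (x2, x3); split=> //; [case: R23 | apply: nR | apply: nR].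
- by exists (x3, x1); split=> //; [case: R31 | apply: nR | apply: nR].
- by exists (x1, x2); split=> //; [case: R12 | apply: nR | apply: nR].
Qed.

(** For an arc [p = (a, b)], the points that close [p] up into a 3-cycle.  This
form, by negation, is open when [R] is closed; [weakly_between], which contains
it by totality, is closed. *)
Definition strictly_between {X : Type} (R : set (X * X)) (p : X * X) : set X :=
  [set y | ~ R (p.1, y) /\ ~ R (y, p.2)].

Definition weakly_between {X : Type} (R : set (X * X)) (p : X * X) : set X :=
  [set y | R (y, p.1) /\ R (p.2, y)].

Lemma closed_comp_pair (T X : topologicalType) (R : set (X * X))
    (f g : T -> X) :
  closed R -> continuous f -> continuous g -> closed [set t | R (f t, g t)].
Proof.
move=> clR cf cg.
have cfg : continuous (fun t => (f t, g t)).
  by move=> t; apply: cvg_pair; [exact: cf | exact: cg].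
exact: (proj1 (continuous_closedP _) cfg).
Qed.

Lemma open_strictly_between (X : topologicalType) (R : set (X * X)) p :
  closed R -> open (strictly_between R p).
Proof.
move=> clR.
apply: openI; apply: closed_openC; apply: closed_comp_pair => // y;
  by [exact: cvg_cst | exact: cvg_id].
Qed.

Lemma closed_weakly_between (X : topologicalType) (R : set (X * X)) p :
  closed R -> closed (weakly_between R p).
Proof.
move=> clR.
apply: closedI; apply: closed_comp_pair => // y;
  by [exact: cvg_cst | exact: cvg_id].
Qed.

(** The collapse of the intersection of the [weakly_between R (p n)] to a
point: a cluster point [(a, b)] of the pairs [p n] satisfies [R (z, a)] and
[R (b, z)] for every [z] in the intersection, and [b] is such a [z].  This
forces [a = b], after which [z] is caught between [a] and itself. *)
Lemma bigcap_weakly_between (X : topologicalType) (R : set (X * X))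
    (p : nat -> X * X) :
  compact [set: X] -> topological_tournament R ->
  (forall n, R (p n)) ->
  (forall m n, n < m -> weakly_between R (p n) (p m).2) ->
  forall x y, (\bigcap_n weakly_between R (p n)) x ->
              (\bigcap_n weakly_between R (p n)) y -> y = x.
Proof.
move=> cX [tR clR] Rp pK.
have cXX : compact [set: X * X].
  by rewrite -setXTT; exact: compact_setX.
have [[a b] clus] := compact_sequence_cluster _ p cXX.
have Rab : R (a, b) by apply: clus => //; exists 0%N.
have cst (z : X) : continuous (fun _ : X * X => z) by exact: cst_continuous.
have cfst : continuous (fst : X * X -> X) by move=> ?; exact: cvg_fst.
have csnd : continuous (snd : X * X -> X) by move=> ?; exact: cvg_snd.
have toa z : (\bigcap_n weakly_between R (p n)) z -> R (z, a).
  move=> Kz; apply: (clus [set q | R (z, q.1)]).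
    exact: closed_comp_pair.
  by exists 0%N => // n _; have [] := Kz n.
have fromb z : (\bigcap_n weakly_between R (p n)) z -> R (b, z).
  move=> Kz; apply: (clus [set q | R (q.2, z)]).
    exact: closed_comp_pair.
  by exists 0%N => // n _; have [] := Kz n.
have Kb : (\bigcap_n weakly_between R (p n)) b.
  move=> n _; apply: (clus (snd @^-1` weakly_between R (p n))).
    by apply: (proj1 (continuous_closedP _) csnd); exact: closed_weakly_between.
  by exists n.+1 => // m; exact: pK.
have ab : a = b by apply: (tournament_anti _ _ tR) => //; exact: toa.
have all_a z : (\bigcap_n weakly_between R (p n)) z -> z = a.
  move=> Kz; apply: (tournament_anti _ _ tR); first exact: toa.
  by rewrite ab; exact: fromb.
by move=> x y /all_a-> /all_a.
Qed.

Theorem proposition1p1 (X : topologicalType) (R : set (X * X)) (x : X)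
    (hX : hausdorff_space X) (cX : compact [set: X])
    (hR : topological_tournament R) (hx : cycle_point R x) :
  Gdelta [set x] /\ has_countable_nbhs_base x.
Proof.
have [tR clR] := hR.
(* Choosing an arc for every set [V] at once, with a dummy value off the
   neighborhoods of [x], lets [U] below be defined by plain recursion. *)
have /choice[arc arcP] : forall V : set X, exists p : X * X, nbhs x V ->
    [/\ V p.1, V p.2, R p, ~ R (p.1, x) & ~ R (x, p.2)].
  move=> V; have [Vx|nVx] := pselect (nbhs x V); last by exists (x, x).
  by have [p ?] := cycle_point_arcs _ _ _ _ tR hx Vx; exists p.
pose U := fix U n : set X :=
  if n is m.+1 then U m `&` strictly_between R (arc (U m)) else [set: X].
have oU n : open (U n).
  elim: n => [|n IHn]; first exact: openT.
  by apply: openI => //; exact: open_strictly_between.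
have Ux n : U n x.
  elim: n => // n IHn; split=> //.
  by have [] := arcP (U n) (open_nbhs_nbhs (conj (oU n) IHn)).
have arcU n := arcP (U n) (open_nbhs_nbhs (conj (oU n) (Ux n))).
have Udecr m n : m <= n -> U n `<=` U m.
  elim: n => [|n IHn]; first by rewrite leqn0 => /eqP ->.
  rewrite leq_eqVlt => /orP[/eqP -> //|/IHn Unm] y [Uy _].
  exact: Unm.
have UK n : U n.+1 `<=` weakly_between R (arc (U n)).
  by move=> y [_ [nRay nRyb]]; split; apply: (tournament_total _ _ tR).
apply: (compact_nested_nbhs_base _ x U (fun n => weakly_between R (arc (U n))))
  => //.
  by move=> n; exact: closed_weakly_between.
move=> y Ky; apply: (bigcap_weakly_between _ R (arc \o U)) => //.
- by move=> n; have [] := arcU n.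
- move=> m n ltnm; have [_ Ub _ _ _] := arcU m.
  by apply: UK; apply: Udecr ltnm _ _.
- by move=> n _; apply: UK.
Qed.
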